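(* Let $d\ge1$ and let $(G_n)_n$ be a sequence of finite connected graphs with $|G_n|\to\infty$, maximal degree at most $d$, and spectral gap $1-\lambda$ of the (lazy) simple random walk bounded below by a positive constant uniformly in $n$. For each $n$ let $s,e\in G_n$ be vertices with $\mathrm{dist}(s,e)=\mathrm{diam}(G_n)$, and run DLA on $G_n$ from $s$ to $e$. Then there is a constant $c>0$, independent of $n$, such that with probability tending to $1$ as $n\to\infty$ the final aggregate $A_\tau$ contains at least $|G_n|^c$ particles.
   Context: Simple random walk on a graph has $P(x,y)=\mathbf 1\{x\sim y\}/\deg(x)$ and stationary measure $\pi(x)\propto\deg(x)$. For $S\subset G$, $T_S=\inf\{t\ge0:X_t\in S\}$, $\partial S=\{x\in S:\exists\,y\notin S,\ y\sim x\}$, and $h_S(x)=\sum_y\pi(y)\Pr_y[X_{T_S}=x]$ is the harmonic measure on $S$ from the stationary distribution. DLA on a finite graph $G$ with start and end vertices $s,e$ is the random process $\{s\}=A_0\subset A_1\subset\cdots$ in which, at each step $t\ge1$, a vertex $a_t$ is chosen with distribution $h_{\partial A_{t-1}}$ (the first point of $\partial A_{t-1}$ hit by a simple random walk started from $\pi$), independently given the past, and $A_t=A_{t-1}\cup\{a_t\}$; the process stops at $\tau=\inf\{t: e\in A_t\}$.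
   Formalization: The boundary ∂S is taken to be the outer vertex boundary {x ∉ S : some y ∈ S, y ~ x} instead of {x ∈ S : some y ∉ S, y ~ x}; with the latter every chosen vertex already lies in the aggregate, which stays {s} and never reaches e. *)

(* Defs.v *)
From Stdlib Require Import Reals ClassicalEpsilon.
From mathcomp Require Import all_boot.

Set Implicit Arguments.
Unset Strict Implicit.
Unset Printing Implicit Defensive.

Section Graph.
Variables (T : finType) (adj : rel T).
Local Open Scope R_scope.

Definition rsum (F : T -> R) : R := \big[Rplus/R0]_(y : T) F y.

Definition deg (x : T) : nat := #|[set y | adj x y]|.

Definition pi (x : T) : R := Rdiv (INR (deg x)) (INR (\sum_(y : T) deg y)%N).

Definition P (x y : T) : R := if adj x y then Rinv (INR (deg x)) else R0.

Definition PL (x y : T) : R :=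
  Rplus (if x == y then Rinv 2 else R0) (Rdiv (P x y) 2).

Definition eigenvalue (M : T -> T -> R) (mu : R) : Prop :=
  exists f : T -> R, (exists x, f x <> R0) /\
    forall x, rsum (fun y => M x y * f y) = (mu * f x).

(* graph distance: least k such that there is a walk of length k from x to y
   (searched in 0 .. #|T|-1, enough for connected graphs) *)
Definition gdist (x y : T) : nat :=
  find (fun k : nat => [exists p : k.-tuple T, path adj x p && (last x p == y)])
       (iota 0 #|T|).

Definition gdiam : nat := \max_(x : T) \max_(y : T) gdist x y.

Definition bdry (S : {set T}) : {set T} :=
  [set x | (x \notin S) && [exists y in S, adj x y]].

(* limit of a real sequence (chosen by classical choice; the sequences used
   below converge) *)
Definition limit (u : nat -> R) : R := epsilon (inhabits R0) (fun l => Un_cv u l).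

(* hit_upto S x t y = Pr_y[ T_S <= t and X_{T_S} = x ] *)
Fixpoint hit_upto (S : {set T}) (x : T) (t : nat) (y : T) : R :=
  match t with
  | 0 => if y \in S then (if y == x then R1 else R0) else R0
  | t'.+1 => if y \in S then (if y == x then R1 else R0)
             else rsum (fun z => P y z * hit_upto S x t' z)
  end.

Definition hitprob (S : {set T}) (x y : T) : R :=
  limit (fun t => hit_upto S x t y).

Definition harm (S : {set T}) (x : T) : R := rsum (fun y => pi y * hitprob S x y).

(* DLA from s to e: dla_law s e t A = Pr[ A_{min(t,tau)} = A ] *)
Fixpoint dla_law (s e : T) (t : nat) (B : {set T}) : R :=
  match t with
  | 0 => if B == [set s] then R1 else R0
  | t'.+1 =>
      \big[Rplus/R0]_(A : {set T})
        (dla_law s e t' A *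
         (if e \in A then (if B == A then R1 else R0)
          else rsum (fun a => if (a \in bdry A) && (B == a |: A)
                              then harm (bdry A) a else R0)))
  end.

(* Pr[ tau < oo and #|A_tau| >= x ] *)
Definition dla_prob_final_ge (s e : T) (x : R) : R :=
  limit (fun t => \big[Rplus/R0]_(A : {set T})
     (if (e \in A) && (if Rle_dec x (INR #|A|) then true else false)
      then dla_law s e t A else R0)).

End Graph.

(* Main.v *)
From Stdlib Require Import Reals Classical ClassicalEpsilon.
From mathcomp Require Import all_boot all_order all_algebra.
From mathcomp Require Import Rstruct ring lra.
(* Imported last so that [eigenvalue], [pi] and [P] are those of [Defs]. *)
Require Import Defs.

(** The exponent of the paper's [|G_n|^c] comes from two estimates.

    (1) If [|A|^2 <= |G|], every point of the outer boundary of [A] has harmonic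
    measure at most [C / |A|].  By reversibility the harmonic measure of [x] is
    governed by the expected hitting time [g] of [A] and its boundary, from the
    neighbours of [x].  Truncated at time [t], [g] satisfies [g - P g <= 1] and
    vanishes on [A].  Testing this against [g], the Poincare inequality bounds
    its mean by [O(|G| / |A|)] and its variance; iterating the lazy walk
    [O(|A|)] times, each step contracting the fluctuation in L2, turns the
    variance bound into a pointwise one of the same order.

    (2) With [theta = d + 1], put [F A] = sum over [v] in [A] of
    [theta ^ dist(s, v)].  By (1), adding a particle increases [F A] in
    expectation by at most the factor [1 + K / |A|], so [F A / |A|^K] is a
    supermartingale as long as [|A| < x], where [x^2 <= |G|].  An aggregate
    containing [e] has [F A >= theta ^ diam >= |G|], hence it has fewer than
    [x] particles with probability at most [x^K / |G|]; take
    [x = |G| ^ (1 / (2 K))]. *)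

Set Implicit Arguments.
Unset Strict Implicit.
Unset Printing Implicit Defensive.

Import Order.TTheory GRing.Theory Num.Theory.
Local Open Scope ring_scope.

Lemma rsumE (T : finType) (F : T -> R) : rsum F = \sum_y F y.
Proof. by []. Qed.

(** * Quadratic forms and the Rayleigh quotient on a finite set *)

Section LinearAlgebra.
Variable T : finType.
Implicit Types (f g h w : T -> R) (K : T -> T -> R).

Definition apply K f (x : T) : R := \sum_y K x y * f y.

(** Cauchy-Schwarz with weights: the nonnegative double sum of [w x * w y * (f x - f y) ^+ 2]
    expands to twice the difference of the two sides. *)
Lemma sqr_sum_le w f : (forall x, 0 <= w x) ->
  (\sum_x w x * f x) ^+ 2 <= (\sum_x w x) * (\sum_x w x * f x ^+ 2).
Proof.
move=> w0; set a := \sum_x w x * f x; set b := \sum_x w x * f x ^+ 2.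
set s := \sum_x w x.
have : 0 <= \sum_x \sum_y w x * w y * (f x - f y) ^+ 2.
  apply: sumr_ge0 => x _; apply: sumr_ge0 => y _.
  by rewrite mulr_ge0 ?sqr_ge0 // mulr_ge0.
have row x : \sum_y w x * w y * (f x - f y) ^+ 2 =
    w x * f x ^+ 2 * s + w x * f x * (-2 * a) + w x * b.
  rewrite /a /b /s !mulr_sumr -!big_split /=; apply: eq_bigr => y _; ring.
under eq_bigr do rewrite row.
rewrite !big_split /= -!mulr_suml -/a -/b -/s.
lra.
Qed.

(** On a finite set an operator with trivial kernel is an invertible matrix; the entries of the
    inverse bound [f] by its image. *)
Lemma injective_apply_bounded K :
  (forall f, (forall x, apply K f x = 0) -> forall x, f x = 0) ->
  exists c, 0 < c /\
    forall f, \sum_x f x ^+ 2 <= c * \sum_x apply K f x ^+ 2.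
Proof.
(* The matrix is transposed because [det0P] and [mulmxK] act on row vectors. *)
move=> injK; pose A : 'M[R]_#|T| := \matrix_(i, j) K (enum_val j) (enum_val i).
have mulA (v : 'rV_#|T|) x :
    (v *m A) 0 (enum_rank x) = apply K (fun y => v 0 (enum_rank y)) x.
  rewrite mxE /apply (reindex enum_rank) /=; last by apply: onW_bij; exact: enum_rank_bij.
  by apply: eq_bigr => y _; rewrite !mxE !enum_rankK mulrC.
have uA : A \in unitmx.
  rewrite unitmxE unitfE; apply/negP => /det0P [v v0 vA]; case/eqP: v0.
  apply/rowP => i; rewrite -[i]enum_valK mxE.
  apply: (injK (fun y => v 0 (enum_rank y))) => x.
  by rewrite -mulA vA mxE.
pose b y x := invmx A (enum_rank y) (enum_rank x).
have inv f x : f x = \sum_y 1 * (apply K f y * b y x).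
  pose v : 'rV_#|T| := \row_i f (enum_val i).
  have /rowP/(_ (enum_rank x)) : v = v *m A *m invmx A by rewrite mulmxK.
  rewrite !mxE enum_rankK => {1}->.
  rewrite (reindex enum_rank) /=; last by apply: onW_bij; exact: enum_rank_bij.
  apply: eq_bigr => y _; rewrite mul1r mulA; congr (_ * _).
  by apply: eq_bigr => z _; rewrite !mxE enum_rankK.
(* A crude common bound for the squared entries of the inverse. *)
pose be := \sum_y \sum_x b y x ^+ 2.
have b_le y x : b y x ^+ 2 <= be.
  rewrite /be (bigD1 y) //= (bigD1 x) //=.
  rewrite -addrA lerDl addr_ge0 ?sumr_ge0 // => *; rewrite ?sumr_ge0 ?sqr_ge0 // => *.
  exact: sqr_ge0.
have be0 : 0 <= be by apply: sumr_ge0 => y _; apply: sumr_ge0 => x _; exact: sqr_ge0.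
have n0 : 0 <= \sum_(y : T) 1 :> R by apply: sumr_ge0.
pose n : R := \sum_(y : T) 1.
exists (n * n * be + 1); split; first by rewrite ltr_wpDl ?mulr_ge0.
move=> f; set S := \sum_x apply K f x ^+ 2.
have S0 : 0 <= S by apply: sumr_ge0 => *; exact: sqr_ge0.
have le x : f x ^+ 2 <= 1 * (n * (be * S)).
  rewrite {1}(inv f x) mul1r; apply: (le_trans (sqr_sum_le _ _)) => //.
  apply: ler_wpM2l => //; rewrite mulr_sumr; apply: ler_sum => y _.
  by rewrite mul1r exprMn mulrC ler_wpM2r ?sqr_ge0.
apply: (le_trans (ler_sum _ (fun x _ => le x))).
rewrite -mulr_suml -/n; nra.
Qed.

Definition quad K f : R := \sum_x f x * apply K f x.

Lemma quad_le K f :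
  quad K f <= (\sum_x \sum_y `|K x y|) * \sum_x f x ^+ 2.
Proof.
set S := \sum_x f x ^+ 2.
have leS x : f x ^+ 2 <= S.
  by rewrite /S (bigD1 x) //= lerDl sumr_ge0 // => *; exact: sqr_ge0.
rewrite /quad mulr_suml; apply: ler_sum => x _.
rewrite /apply mulr_sumr mulr_suml; apply: ler_sum => y _.
rewrite mulrCA; apply: (le_trans (ler_norm _)); rewrite normrM.
apply: ler_wpM2l => //; rewrite ler_norml.
have := leS x; have := leS y; have := sqr_ge0 (f x + f y).
have := sqr_ge0 (f x - f y); rewrite !expr2 => *; apply/andP; split; lra.
Qed.

Lemma apply_comb K f h t x :
  apply K (fun y => f y + t * h y) x = apply K f x + t * apply K h x.
Proof.
rewrite /apply mulr_sumr -big_split /=; apply: eq_bigr => y _; ring.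
Qed.

Lemma applyC K f h : (forall x y, K x y = K y x) ->
  \sum_x f x * apply K h x = \sum_x h x * apply K f x.
Proof.
move=> symK; rewrite /apply.
under eq_bigr do rewrite mulr_sumr.
under [RHS]eq_bigr do rewrite mulr_sumr.
rewrite exchange_big /=; apply: eq_bigr => y _; apply: eq_bigr => x _.
rewrite (symK x y); ring.
Qed.

(* If the supremum of the Rayleigh quotient were not an eigenvalue, then
   [rho w - A] would have a bounded inverse, and a positive semidefinite form
   with bounded inverse is coercive, so the supremum could be lowered. *)
Lemma rayleigh_sup_eigenvalue (x0 : T) w K :
  (forall x, 0 < w x) -> (forall x y, K x y = K y x) ->
  exists rho,
    (exists f, (exists x, f x <> 0) /\
       forall x, apply K f x = rho * (w x * f x)) /\
    forall f, quad K f <= rho * \sum_x w x * f x ^+ 2.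
Proof.
move=> w0 symK; pose nw f := \sum_x w x * f x ^+ 2.
have nw0 f : 0 <= nw f.
  by apply: sumr_ge0 => x _; rewrite mulr_ge0 ?sqr_ge0 // ltW.
pose V := \sum_x (w x)^-1.
have V0 : 0 <= V by apply: sumr_ge0 => x _; rewrite invr_ge0 ltW.
have sq_nw f : \sum_x f x ^+ 2 <= V * nw f.
  rewrite /nw mulr_sumr; apply: ler_sum => x _.
  have : (w x)^-1 <= V.
    rewrite /V (bigD1 x) //= lerDl sumr_ge0 // => y _; by rewrite invr_ge0 ltW.
  move=> le; apply: (@le_trans _ _ ((w x)^-1 * (w x * f x ^+ 2))).
    by rewrite mulKf ?gt_eqF.
  by apply: ler_wpM2r => //; rewrite mulr_ge0 ?sqr_ge0 // ltW.
pose E r := exists f, 0 < nw f /\ r = quad K f / nw f.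
have Ebd : bound E.
  exists ((\sum_x \sum_y `|K x y|) * V) => r [f [f0 ->]]; apply/RleP.
  rewrite ler_pdivrMr // -mulrA; apply: (le_trans (quad_le K f)).
  by apply: ler_wpM2l => //; do 2![apply: sumr_ge0 => ? _].
have Eex : exists r, E r.
  exists (quad K (fun=> 1) / nw (fun=> 1)), (fun=> 1); split=> //.
  rewrite /nw (bigD1 x0) //= expr1n mulr1 ltr_pwDl // sumr_ge0 // => x _.
  by rewrite mulr_ge0 ?ltW.
have [rho [ub lub]] := completeness E Ebd Eex.
have main f : quad K f <= rho * nw f.
  have [f0|f0] := boolP (0 < nw f).
    by rewrite -ler_pdivrMr //; apply/RleP; apply: ub; exists f.
  have nwf : nw f = 0 by apply/eqP; rewrite eq_le nw0 andbT leNgt.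
  have f00 x : f x = 0.
    have := psumr_eq0P (fun x _ => mulr_ge0 (ltW (w0 x)) (sqr_ge0 (f x))) nwf.
    by move/(_ x isT)/eqP; rewrite mulf_eq0 gt_eqF //= sqrf_eq0 => /eqP.
  by rewrite nwf mulr0 /quad big1 // => x _; rewrite f00 mul0r.
exists rho; split=> //; apply: NNPP => noeig.
pose L x y := rho * (w x * (x == y)%:R) - K x y.
have LE f x : apply L f x = rho * (w x * f x) - apply K f x.
  rewrite /apply /L; under eq_bigr do rewrite mulrBl.
  rewrite sumrB; congr (_ - _).
  rewrite (bigD1 x) //= eqxx mulr1 big1 ?addr0 ?mulrA // => y.
  by rewrite eq_sym => /negbTE->; rewrite !mulr0 mul0r.
have symL x y : L x y = L y x.
  rewrite /L symK eq_sym; case: eqP => [->//|_]; by rewrite !mulr0.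
have injL f : (forall x, apply L f x = 0) -> forall x, f x = 0.
  move=> Lf x; apply: NNPP => fx; apply: noeig; exists f; split; first by exists x.
  by move=> y; move: (Lf y); rewrite LE => /eqP; rewrite subr_eq0 => /eqP.
have [c [c0 bd]] := injective_apply_bounded injL.
have QE f : quad L f = rho * nw f - quad K f.
  rewrite /quad /nw mulr_sumr -sumrB; apply: eq_bigr => x _; rewrite LE; ring.
have Q0 f : 0 <= quad L f by rewrite QE subr_ge0.
pose c' := \sum_x \sum_y `|L x y| + 1.
have c'0 : 0 < c'.
  by rewrite ltr_wpDl // sumr_ge0 // => *; rewrite sumr_ge0.
have Qle f : quad L f <= c' * \sum_x f x ^+ 2.
  apply: (le_trans (quad_le L f)); apply: ler_wpM2r; last by rewrite lerDl.
  by apply: sumr_ge0 => *; exact: sqr_ge0.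
have Qcomb f h t : quad L (fun y => f y + t * h y) =
    quad L f + t * (2 * \sum_x h x * apply L f x) + t ^+ 2 * quad L h.
  rewrite {1}/quad; under eq_bigr do rewrite apply_comb.
  have -> : 2 * \sum_x h x * apply L f x =
      \sum_x h x * apply L f x + \sum_x f x * apply L h x.
    by rewrite (applyC f h symL); ring.
  rewrite /quad -!big_split /= !mulr_sumr -!big_split /=.
  apply: eq_bigr => x _; ring.
have coer f : \sum_x apply L f x ^+ 2 <= c' * quad L f.
  set S := \sum_x apply L f x ^+ 2.
  (* Nonnegativity of the form at [f + t * apply L f], with [t = - c'^-1] minimising the upper bound
     that [Qle] gives. *)
  have := Q0 (fun y => f y + (- c'^-1) * apply L f y); rewrite Qcomb.
  have -> : \sum_x apply L f x * apply L f x = S by [].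
  have := Qle (apply L f); rewrite -/S => le1 le2.
  have : 0 <= c' * (quad L f + - c'^-1 * (2 * S) + (- c'^-1) ^+ 2 * (c' * S)).
    rewrite mulr_ge0 ?(ltW c'0) //; apply: (le_trans le2).
    by rewrite lerD2l ler_wpM2l ?sqr_ge0.
  have -> : c' * (quad L f + - c'^-1 * (2 * S) + (- c'^-1) ^+ 2 * (c' * S)) =
     c' * quad L f - S by field; rewrite gt_eqF.
  by rewrite subr_ge0.
pose W := \sum_x w x.
have W0 : 0 < W.
  rewrite /W (bigD1 x0) //= ltr_pwDl // sumr_ge0 // => x _; exact: ltW.
have nwW f : nw f <= W * \sum_x f x ^+ 2.
  rewrite /nw mulr_sumr; apply: ler_sum => x _; apply: ler_wpM2r; first exact: sqr_ge0.
  by rewrite /W (bigD1 x) //= lerDl sumr_ge0 // => y _; exact: ltW.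
pose k := W * (c * c').
have k0 : 0 < k by rewrite !mulr_gt0.
have nwk f : nw f <= k * quad L f.
  apply: (le_trans (nwW f)); rewrite /k -mulrA ler_pM2l // -mulrA.
  by apply: (le_trans (bd f)); rewrite ler_pM2l.
(* By [nwk] every Rayleigh quotient is at most [rho - k^-1], which contradicts that [rho] is their
   least upper bound. *)
have : rho <= rho - k^-1.
  apply/RleP; apply: lub => r [f [f0 ->]]; apply/RleP; rewrite ler_pdivrMr //.
  have : k^-1 * nw f <= quad L f by rewrite ler_pdivrMl.
  rewrite QE -/(nw f) mulrBl; lra.
by rewrite lerBrDr gerDl leNgt invr_gt0 k0.
Qed.

End LinearAlgebra.

(** * Spectral gap and hitting times *)

Section Walk.
Variables (T : finType) (adj : rel T).
Hypothesis sym_adj : symmetric adj.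
Hypothesis connected_adj : forall x y, connect adj x y.
Hypothesis deg_gt0 : forall x, (0 < deg adj x)%N.
Implicit Types (f g : T -> R) (x y z : T).

Definition weight x : R := (deg adj x)%:R.
Definition vol : R := \sum_x weight x.

Local Notation w := weight.
Local Notation Pf := (apply (P adj)).
Local Notation PLf := (apply (PL adj)).

Lemma weight_ge1 x : 1 <= w x.
Proof. by rewrite /w ler1n. Qed.

Lemma weight_gt0 x : 0 < w x.
Proof. exact: lt_le_trans (weight_ge1 x). Qed.

Lemma weight_ge0 x : 0 <= w x.
Proof. exact: ltW (weight_gt0 x). Qed.

Hint Resolve weight_ge0 weight_gt0 : core.

Lemma card_le_weight (A : {set T}) : #|A|%:R <= \sum_(x in A) w x.
Proof. by rewrite -sum1_card natr_sum; apply: ler_sum => x _; exact: weight_ge1. Qed.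

Lemma vol_ge_weight (A : {set T}) : \sum_(x in A) w x <= vol.
Proof.
rewrite /vol [leRHS](bigID (mem A)) /= lerDl sumr_ge0 // => *; exact: weight_ge0.
Qed.

Lemma card_le_vol : #|T|%:R <= vol.
Proof.
have := card_le_weight [set: T]; rewrite cardsT => /le_trans; apply; exact: vol_ge_weight.
Qed.

Lemma vol_gt0 x : 0 < vol.
Proof.
apply: lt_le_trans card_le_vol; rewrite ltr0n; apply/card_gt0P; by exists x.
Qed.

Lemma pi_weight x : pi adj x = w x / vol.
Proof. by rewrite /pi RdivE !INRE natr_sum. Qed.

Lemma P_adj x y : P adj x y = (adj x y)%:R / w x.
Proof.
by rewrite /P; case: adj; rewrite ?mul0r // mul1r RinvE INRE.
Qed.

Lemma P_ge0 x y : 0 <= P adj x y.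
Proof. by rewrite P_adj divr_ge0. Qed.

Hint Resolve P_ge0 : core.

Lemma weight_P x y : w x * P adj x y = (adj x y)%:R.
Proof. by rewrite P_adj mulrC mulfVK // gt_eqF. Qed.

Lemma sum_adj x : \sum_y (adj x y)%:R = w x.
Proof.
rewrite /w /deg -sum1_card natr_sum [RHS]big_mkcond /=; apply: eq_bigr => y _.
by rewrite inE; case: adj.
Qed.

Lemma sum_P x : \sum_y P adj x y = 1.
Proof.
under eq_bigr do rewrite P_adj.
by rewrite -mulr_suml sum_adj divff // gt_eqF.
Qed.

Lemma weight_apply_P f g :
  \sum_x w x * f x * Pf g x = \sum_x \sum_y (adj x y)%:R * (f x * g y).
Proof.
apply: eq_bigr => x _; rewrite /apply mulr_sumr; apply: eq_bigr => y _.
rewrite -weight_P; ring.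
Qed.

Lemma weight_apply_PC f g :
  \sum_x w x * f x * Pf g x = \sum_x w x * g x * Pf f x.
Proof.
rewrite !weight_apply_P exchange_big /=; apply: eq_bigr => y _.
by apply: eq_bigr => x _; rewrite sym_adj (mulrC (f x)).
Qed.

Lemma apply_P_const (c : R) x : Pf (fun=> c) x = c.
Proof. by rewrite /apply -mulr_suml sum_P mul1r. Qed.

Lemma sum_weight_P f : \sum_x w x * Pf f x = \sum_x w x * f x.
Proof.
have := weight_apply_PC (fun=> 1) f.
under eq_bigr do rewrite mulr1.
by under [RHS]eq_bigr do rewrite apply_P_const mulr1.
Qed.

Lemma apply_P_le f g x : (forall y, f y <= g y) -> Pf f x <= Pf g x.
Proof. by move=> le; apply: ler_sum => y _; rewrite ler_wpM2l. Qed.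

Lemma PLE x y : PL adj x y = ((x == y)%:R + P adj x y) / 2.
Proof.
rewrite /PL mulrDl; congr (_ + _).
by case: eqP => _; rewrite ?mul0r // mul1r RinvE.
Qed.

Lemma apply_PL f x : PLf f x = (f x + Pf f x) / 2.
Proof.
rewrite /apply; under eq_bigr do rewrite PLE.
rewrite (_ : f x + _ = \sum_y ((x == y)%:R + P adj x y) * f y).
  by rewrite mulr_suml; apply: eq_bigr => y _; ring.
under [RHS]eq_bigr do rewrite mulrDl.
rewrite big_split /=; congr (_ + _).
rewrite (bigD1 x) //= eqxx mul1r big1 ?addr0 // => y.
by rewrite eq_sym => /negbTE->; rewrite mul0r.
Qed.

Lemma apply_PL_le f g x : (forall y, f y <= g y) -> PLf f x <= PLf g x.
Proof.
by move=> le; rewrite !apply_PL ler_pM2r ?invr_gt0 // lerD // apply_P_le.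
Qed.

Lemma sum_weight_PL f : \sum_x w x * PLf f x = \sum_x w x * f x.
Proof.
under eq_bigr do rewrite apply_PL mulrA mulrDr.
rewrite -mulr_suml big_split /= sum_weight_P; lra.
Qed.

(** The Dirichlet form of the walk; the factor 2 appears because each edge is summed in both
    directions. *)
Lemma dirichlet f :
  \sum_x \sum_y (adj x y)%:R * (f x - f y) ^+ 2 =
  2 * (\sum_x w x * f x ^+ 2 - \sum_x w x * f x * Pf f x).
Proof.
have E1 : \sum_x w x * f x ^+ 2 = \sum_x \sum_y (adj x y)%:R * f x ^+ 2.
  by apply: eq_bigr => x _; rewrite -mulr_suml sum_adj.
have E2 : \sum_x w x * f x ^+ 2 = \sum_x \sum_y (adj x y)%:R * f y ^+ 2.
  rewrite E1 exchange_big /=; apply: eq_bigr => y _.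
  by apply: eq_bigr => x _; rewrite sym_adj.
rewrite mulrBr mulr_natl mulr2n {1}E1 E2 weight_apply_P mulr_sumr -big_split -sumrB /=.
apply: eq_bigr => x _; rewrite mulr_sumr -big_split -sumrB /=.
apply: eq_bigr => y _; ring.
Qed.

(** A harmonic function has zero Dirichlet energy, so it is constant along edges, and connectivity
    does the rest. *)
Lemma harmonic_const f : (forall x, Pf f x = f x) -> forall x y, f x = f y.
Proof.
move=> harmf x y.
have : \sum_x \sum_y (adj x y)%:R * (f x - f y) ^+ 2 = 0.
  rewrite dirichlet -sumrB big1 ?mulr0 // => z _; rewrite harmf; ring.
have ge0 u v : 0 <= (adj u v)%:R * (f u - f v) ^+ 2.
  by rewrite mulr_ge0 ?sqr_ge0.
move/(psumr_eq0P (fun u _ => sumr_ge0 _ (fun v _ => ge0 u v))) => D0.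
have edge u v : adj u v -> f u = f v.
  move=> uv; have /(_ v isT) := psumr_eq0P (fun v _ => ge0 u v) (D0 u isT).
  by move/eqP; rewrite uv mul1r sqrf_eq0 subr_eq0 => /eqP.
case/connectP: (connected_adj x y) => p pth ->{y}.
elim: p x pth => //= z p IH x /andP[/edge-> /IH].
by [].
Qed.

Variable gam : R.
Hypothesis gam_gt0 : 0 < gam.
Hypothesis gam_le1 : gam <= 1.
Hypothesis gap : forall mu, eigenvalue (PL adj) mu -> mu <> 1 -> mu <= 1 - gam.

(** The hypothesis [gap] speaks of eigenvalues only. The top of the Rayleigh quotient is itself an
    eigenvalue, which turns [gap] into a Poincare inequality. *)
Lemma gap_quad f : \sum_x w x * f x = 0 ->
  \sum_x w x * f x * PLf f x <= (1 - gam) * \sum_x w x * f x ^+ 2.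
Proof.
case: (pickP T) => [x0 _ f0|T0]; last by rewrite !big1 ?mulr0 // => x; move: (T0 x).
(* Subtracting the projection onto constants leaves the form unchanged on mean-zero functions, so
   the supremum may run over all functions. *)
pose K x y := w x * PL adj x y - w x * w y / vol.
have KE g x : apply K g x = w x * (PLf g x - (\sum_y w y * g y) / vol).
  rewrite /apply /K mulrBr mulr_sumr mulr_suml mulr_sumr -sumrB.
  apply: eq_bigr => y _; ring.
have symK x y : K x y = K y x.
  rewrite /K; congr (_ - _); last by rewrite (mulrC (w x)).
  rewrite !PLE !mulrA !mulrDr !weight_P sym_adj eq_sym; congr ((_ + _) / _).
  by case: eqP => [->//|]; rewrite !mulr0.
have [rho [[h [[x hx] hE]] le]] := rayleigh_sup_eigenvalue x0 weight_gt0 symK.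
set M := (\sum_y w y * h y) / vol in hE.
have {}hE y : PLf h y - M = rho * h y.
  by apply: (@mulfI _ (w y)); rewrite ?gt_eqF // -KE hE; ring.
have volM : \sum_y w y * M = \sum_y w y * h y.
  by rewrite -mulr_suml -/vol mulrC divfK // gt_eqF // (vol_gt0 x0).
have rhoM : rho * (\sum_y w y * h y) = 0.
  rewrite mulr_sumr; under eq_bigr do rewrite mulrCA -hE mulrBr.
  by rewrite sumrB sum_weight_PL volM subrr.
have rho_le : rho <= 1 - gam.
  (* Either [rho = 0], where [gam <= 1] suffices, or the eigenvector [h] has mean zero and is an
     eigenvector of [PL]. *)
  have [->|rho0] := eqVneq rho 0; first by rewrite subr_ge0.
  have h0 : \sum_y w y * h y = 0 by apply/eqP; move/eqP: rhoM; rewrite mulf_eq0 (negbTE rho0).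
  have PLh y : PLf h y = rho * h y by rewrite -hE /M h0 mul0r subr0.
  apply: gap; first by exists h; split; [exists x | exact: PLh].
  (* Eigenvalue 1 is excluded: [h] would be harmonic, hence constant, hence zero by its mean. *)
  move=> rho1; apply: hx.
  have hc y : h y = h x.
    apply: harmonic_const => z; have := PLh z; rewrite apply_PL rho1; lra.
  have : vol * h x = 0.
    by rewrite -h0 /vol mulr_suml; apply: eq_bigr => y _; rewrite hc.
  by move/eqP; rewrite mulf_eq0 gt_eqF ?(vol_gt0 x0) //= => /eqP.
have := le f; rewrite /quad.
have -> : \sum_x f x * apply K f x = \sum_x w x * f x * PLf f x.
  by apply: eq_bigr => y _; rewrite KE f0 mul0r subr0; ring.
move/le_trans; apply; apply: ler_wpM2r => //.
by apply: sumr_ge0 => y _; rewrite mulr_ge0 ?sqr_ge0.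
Qed.

(** Laziness makes [PL] positive semidefinite, so its square is dominated by [PL] itself: the
    difference of the two forms is a quarter of [|f|^2 - |P f|^2], nonnegative by Jensen. *)
Lemma PL_contract f : \sum_x w x * f x = 0 ->
  \sum_x w x * PLf f x ^+ 2 <= (1 - gam) * \sum_x w x * f x ^+ 2.
Proof.
move=> f0; apply: le_trans (gap_quad f0).
have jensen : \sum_x w x * Pf f x ^+ 2 <= \sum_x w x * f x ^+ 2.
  rewrite -(sum_weight_P (fun x => f x ^+ 2)); apply: ler_sum => x _.
  rewrite ler_wpM2l //.
  by have := sqr_sum_le f (P_ge0 x); rewrite sum_P mul1r.
rewrite -subr_ge0 -sumrB.
rewrite (_ : \sum_x _ = (\sum_x w x * f x ^+ 2 - \sum_x w x * Pf f x ^+ 2) / 4).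
  by rewrite divr_ge0 ?subr_ge0.
rewrite -sumrB mulr_suml; apply: eq_bigr => x _; rewrite apply_PL; by field.
Qed.

Lemma iter_PL_contract k f : \sum_x w x * f x = 0 ->
  \sum_x w x * iter k PLf f x ^+ 2 <= (1 - gam) ^+ k * \sum_x w x * f x ^+ 2.
Proof.
move=> f0.
have mean0 j : \sum_x w x * iter j PLf f x = 0.
  by elim: j => //= j IH; rewrite sum_weight_PL.
elim: k => [|k IH]; first by rewrite expr0 mul1r.
rewrite exprS -mulrA; apply: (le_trans (PL_contract (mean0 k))).
by rewrite ler_wpM2l // subr_ge0.
Qed.

(** * Mean and pointwise bounds for functions with [g - P g <= 1] that vanish on a set *)

Section Subsolution.
Variables (B : {set T}) (g : T -> R).
Hypothesis g_ge0 : forall x, 0 <= g x.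
Hypothesis gB : forall x, x \in B -> g x = 0.
Hypothesis g_sub : forall x, g x - Pf g x <= 1.

Let m := (\sum_x w x * g x) / vol.

Let m_ge0 : 0 <= m.
Proof.
by rewrite divr_ge0 ?sumr_ge0 // => *; rewrite mulr_ge0.
Qed.

Let sum_g (x0 : T) : \sum_x w x * g x = vol * m.
Proof. by rewrite mulrC divfK // gt_eqF // (vol_gt0 x0). Qed.

Let v x := g x - m.

Let v_mean (x0 : T) : \sum_x w x * v x = 0.
Proof.
under eq_bigr do rewrite mulrBr.
by rewrite sumrB -mulr_suml (sum_g x0) subrr.
Qed.

Let v_PL x : v x - PLf v x = (g x - Pf g x) / 2.
Proof.
rewrite apply_PL /v.
have -> : Pf (fun y => g y - m) x = Pf g x - m.
  rewrite /apply; under eq_bigr do rewrite mulrBr.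
  by rewrite sumrB -mulr_suml sum_P mul1r.
by field.
Qed.

(** The Poincare inequality bounds the variance by the energy of [v], and the energy is controlled
    by testing [v - PL v], at most 1/2, against [g >= 0]. *)
Let variance (x0 : T) : gam * \sum_x w x * v x ^+ 2 <= vol * m.
Proof.
have := gap_quad (v_mean x0).
have : \sum_x w x * v x ^+ 2 - \sum_x w x * v x * PLf v x <= vol * m; last lra.
rewrite -sumrB.
(* In the energy [v] may be replaced by [g = v + m], because [v - PL v] has mean zero. *)
have -> : \sum_x (w x * v x ^+ 2 - w x * v x * PLf v x) =
    \sum_x w x * g x * (v x - PLf v x) - m * \sum_x (w x * v x - w x * PLf v x).
  rewrite mulr_sumr -sumrB; apply: eq_bigr => x _; 
  by rewrite (_ : g x = v x + m) ?/v ?addrNK //; ring.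
rewrite sumrB sum_weight_PL subrr mulr0 subr0 -(sum_g x0).
apply: ler_sum => x _; rewrite v_PL ler_piMr ?mulr_ge0 //.
have := g_sub x; lra.
Qed.

(** On [B] the fluctuation [v] equals [-m], so the variance is at least [m ^+ 2] times the weight of
    [B]; against the linear upper bound [variance] this limits [m]. *)
Lemma subsolution_mean :
  gam * (\sum_(x in B) w x) * (\sum_x w x * g x) <= vol ^+ 2.
Proof.
case: (pickP T) => [x0 _|T0]; last by rewrite [X in _ * X]big1 ?mulr0 ?sqr_ge0 // => x; move: (T0 x).
rewrite (sum_g x0).
have := variance x0; set S := \sum_x _ => varS.
have leS : (\sum_(x in B) w x) * m ^+ 2 <= S.
  rewrite /S [leRHS](bigID (mem B)) /= mulr_suml.
  rewrite ler_wpDr ?sumr_ge0 // => [x _|]; first by rewrite mulr_ge0 ?sqr_ge0.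
  by apply: ler_sum => x xB; rewrite /v gB // sub0r sqrrN.
have V := vol_gt0 x0.
clearbody m.
have [m0|] := ltP 0 m; last first.
  move=> m0; have -> : m = 0 by apply: le_anti; rewrite m0 m_ge0.
  by rewrite !mulr0 sqr_ge0.
rewrite mulrCA [vol ^+ 2]expr2 ler_pM2l // -(ler_pM2r m0) -!mulrA -expr2.
by apply: le_trans varS; rewrite ler_pM2l.
Qed.

(** Each use of [g - P g <= 1] trades [v] for [PL v] at cost at most 1. After [L * a] steps the L2
    norm has shrunk enough to control the value at a single point. *)
Lemma subsolution_le (a L : nat) z :
  (0 < a)%N -> (a <= #|B|)%N -> 1 <= L%:R * gam ->
  g z <= (L * a)%:R + 2 * vol / (gam * a%:R).
Proof.
move=> a0 aB L1; set k := (L * a)%N.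
have vE x : v x = g x - m by [].
clearbody v; clearbody m.
have V := vol_gt0 z.
have a0R : 0 < a%:R :> R by rewrite ltr0n.
have aBR : a%:R <= \sum_(x in B) w x.
  by apply: le_trans (card_le_weight B); rewrite ler_nat.
pose c := vol / (gam * a%:R).
have c0 : 0 < c by rewrite divr_gt0 ?mulr_gt0.
have mc : m <= c.
  have := subsolution_mean; rewrite (sum_g z) mulrCA expr2 ler_pM2l // => le_vol.
  rewrite /c ler_pdivlMr ?mulr_gt0 // mulrC; apply: le_trans le_vol.
  by rewrite ler_wpM2r // ler_pM2l.
have iterPL j x : g x <= j%:R + (m + iter j PLf v x).
  elim: j x => [|j IH] x; first by rewrite /= vE add0r addrCA subrr addr0.
  have := v_PL x; have := g_sub x.
  have : PLf v x <= PLf (fun y => j%:R + iter j PLf v y) x.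
    by apply: apply_PL_le => y; rewrite vE lerBlDl addrCA; exact: IH.
  have -> : PLf (fun y => j%:R + iter j PLf v y) x = j%:R + PLf (iter j PLf v) x.
    rewrite !apply_PL.
    have -> : Pf (fun y => j%:R + iter j PLf v y) x = j%:R + Pf (iter j PLf v) x.
      rewrite /apply; under eq_bigr do rewrite mulrDr.
      by rewrite big_split /= -mulr_suml sum_P mul1r.
    by field.
  rewrite vE -[j.+1%:R]natr1 iterS; lra.
(* Bernoulli's inequality turns the exponential contraction into a factor at most [1 / a] after
   [L * a] steps, since [L * gam >= 1]. *)
have bern j : (1 + j%:R * gam) * (1 - gam) ^+ j <= 1.
  elim: j => [|j IH]; first by rewrite mul0r addr0 mul1r.
  apply: le_trans IH; rewrite exprS mulrA ler_wpM2r ?exprn_ge0 ?subr_ge0 //.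
  rewrite -subr_ge0 -natr1.
  have -> : 1 + j%:R * gam - (1 + (j%:R + 1) * gam) * (1 - gam) =
    (j%:R + 1) * gam ^+ 2 by ring.
  by rewrite mulr_ge0 ?sqr_ge0 // addr_ge0.
have sq : iter k PLf v z ^+ 2 <= c ^+ 2.
  set X := _ ^+ 2; set q := (1 - gam) ^+ k.
  have q0 : 0 <= q by rewrite exprn_ge0 ?subr_ge0.
  have q1 : a%:R * q <= 1.
    apply: le_trans (bern k); rewrite ler_wpM2r // /k natrM mulrAC.
    rewrite -[leLHS]mul1r; apply: (@le_trans _ _ (L%:R * gam * a%:R)); last by rewrite lerDr.
    by rewrite ler_wpM2r.
  (* One squared value is at most the weighted L2 norm, as all weights are at least 1. *)
  have XS : X <= q * \sum_x w x * v x ^+ 2.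
    apply: le_trans (iter_PL_contract k (v_mean z)).
    rewrite (bigD1 z) //= ler_wpDr ?sumr_ge0 // => [x _|].
      by rewrite mulr_ge0 ?sqr_ge0.
    by rewrite ler_peMl ?sqr_ge0 ?weight_ge1.
  have -> : c ^+ 2 = vol * c / (gam * a%:R) by rewrite /c; field; rewrite !gt_eqF.
  rewrite ler_pdivlMr ?mulr_gt0 //.
  apply: (@le_trans _ _ (q * (vol * m) * a%:R)).
    rewrite mulrA ler_pM2r // mulrC; apply: (le_trans (ler_wpM2l (ltW gam_gt0) XS)).
    by rewrite mulrCA ler_wpM2l // variance.
  rewrite mulrAC [q * _]mulrC; apply: (@le_trans _ _ (1 * (vol * m))).
    by rewrite ler_wpM2r // mulr_ge0 // ltW.
  by rewrite mul1r ler_pM2l.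
have {}sq : iter k PLf v z <= c.
  apply: le_trans (ler_norm _) _; rewrite -(ger0_norm (ltW c0)).
  by rewrite -ler_sqr ?nnegrE // !real_normK ?num_real.
have := iterPL k z.
have -> : 2 * vol / (gam * a%:R) = 2 * c by rewrite /c mulrA.
lra.
Qed.

End Subsolution.
End Walk.

(** * The killed walk *)

Section KilledWalk.
Variables (T : finType) (adj : rel T).
Hypothesis sym_adj : symmetric adj.
Hypothesis connected_adj : forall x y, connect adj x y.
Hypothesis deg_gt0 : forall x, (0 < deg adj x)%N.
Implicit Types (f g : T -> R) (x y z : T) (B S : {set T}).

Local Notation w := (weight adj).
Local Notation vol := (vol adj).
Local Notation Pf := (apply (P adj)).

Let w_ge0 x : 0 <= w x := weight_ge0 deg_gt0 x.
Let w_gt0 x : 0 < w x := weight_gt0 deg_gt0 x.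
Let Pge0 x y : 0 <= P adj x y := P_ge0 deg_gt0 x y.
Hint Resolve w_ge0 w_gt0 Pge0 : core.

(** Rows and columns of [B] are both erased, which keeps the kernel reversible with respect to
    [weight]. *)
Definition killed B x y : R := if (x \in B) || (y \in B) then 0 else P adj x y.
Local Notation Q B := (apply (killed B)).
Definition alive B x : R := (x \notin B)%:R.
(** The probability that the walk from a given point has not met [B] up to and including time
    [t]. *)
Definition survival B t := iter t (Q B) (alive B).
(** The Green operator truncated at time [t]; applied to [alive B] it is the expectation of the
    hitting time of [B] capped at [t]. *)
Definition green B f t x := \sum_(j < t) iter j (Q B) f x.

Lemma killed_ge0 B x y : 0 <= killed B x y.
Proof. by rewrite /killed; case: ifP. Qed.

Lemma apply_killed_le B f g x : (forall y, f y <= g y) -> Q B f x <= Q B g x.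
Proof. by move=> le; apply: ler_sum => y _; rewrite ler_wpM2l ?killed_ge0. Qed.

Lemma apply_killed_ge0 B f x : (forall y, 0 <= f y) -> 0 <= Q B f x.
Proof. by move=> f0; apply: sumr_ge0 => y _; rewrite mulr_ge0 ?killed_ge0. Qed.

Lemma apply_killed_in B f x : x \in B -> Q B f x = 0.
Proof. by move=> xB; apply: big1 => y _; rewrite /killed xB mul0r. Qed.

Lemma apply_killed_out B f x : x \notin B -> (forall y, y \in B -> f y = 0) ->
  Q B f x = Pf f x.
Proof.
move=> /negbTE xB f0; apply: eq_bigr => y _; rewrite /killed xB /=.
by case: ifP => // /f0->; rewrite !mulr0.
Qed.

Lemma apply_killed_sum B (n : nat) (F : nat -> T -> R) x :
  Q B (fun y => \sum_(j < n) F j y) x = \sum_(j < n) Q B (F j) x.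
Proof.
rewrite /apply; under eq_bigr do rewrite mulr_sumr.
by rewrite exchange_big.
Qed.

Lemma iter_killed_ge0 B f t x : (forall y, 0 <= f y) -> 0 <= iter t (Q B) f x.
Proof. by move=> f0; elim: t x => //= t IH x; apply: apply_killed_ge0. Qed.

Lemma iter_killed_in B f t x : (forall y, y \in B -> f y = 0) -> x \in B ->
  iter t (Q B) f x = 0.
Proof. by move=> f0; case: t => [|t] xB; [exact: f0 | exact: apply_killed_in]. Qed.

Lemma killedC B f g : \sum_x w x * f x * Q B g x = \sum_x w x * g x * Q B f x.
Proof.
have symK x y : w x * killed B x y = w y * killed B y x.
  rewrite /killed orbC; case: ifP; rewrite ?mulr0 // !weight_P //.
  by rewrite sym_adj.
have := applyC f g symK.
have E h k : \sum_x h x * apply (fun x y => w x * killed B x y) k x =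
    \sum_x w x * h x * Q B k x.
  apply: eq_bigr => x _; rewrite /apply !mulr_sumr; apply: eq_bigr => y _; ring.
by rewrite !E.
Qed.

Lemma iter_killedC B f g t :
  \sum_x w x * f x * iter t (Q B) g x = \sum_x w x * g x * iter t (Q B) f x.
Proof.
elim: t f => [|t IH] f /=; first by apply: eq_bigr => x _; rewrite mulrAC.
rewrite killedC -/(iter t.+1 (Q B) f) iterSr -IH.
by apply: eq_bigr => x _; rewrite mulrAC.
Qed.

(** Reversibility. It later replaces a sum over starting points, for arrival at a fixed [x], by
    expected hitting times from the neighbours of [x]. *)
Lemma greenC B f g t :
  \sum_x w x * f x * green B g t x = \sum_x w x * g x * green B f t x.
Proof.
rewrite /green; under eq_bigr do rewrite mulr_sumr.
under [RHS]eq_bigr do rewrite mulr_sumr.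
rewrite exchange_big [RHS]exchange_big /=.
by apply: eq_bigr => j _; exact: iter_killedC.
Qed.

Lemma greenS B f t x : green B f t.+1 x = f x + Q B (green B f t) x.
Proof. by rewrite /green apply_killed_sum big_ord_recl. Qed.

Lemma green_ge0 B f t x : (forall y, 0 <= f y) -> 0 <= green B f t x.
Proof. by move=> f0; apply: sumr_ge0 => j _; apply: iter_killed_ge0. Qed.

Lemma green_in B f t x : (forall y, y \in B -> f y = 0) -> x \in B ->
  green B f t x = 0.
Proof. by move=> f0 xB; apply: big1 => j _; apply: iter_killed_in. Qed.

Lemma alive_in B x : x \in B -> alive B x = 0.
Proof. by rewrite /alive => ->. Qed.

Lemma alive_ge0 B x : 0 <= alive B x.
Proof. by rewrite /alive. Qed.

Lemma survival_ge0 B t x : 0 <= survival B t x.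
Proof. by apply: iter_killed_ge0 => y; exact: alive_ge0. Qed.

Lemma survival_in B t x : x \in B -> survival B t x = 0.
Proof. by apply: iter_killed_in => y; exact: alive_in. Qed.

Lemma survivalS_le B t x : survival B t.+1 x <= survival B t x.
Proof.
elim: t x => [|t IH] x; last by apply: apply_killed_le.
have [xB|xB] := boolP (x \in B).
  by rewrite survival_in ?survival_ge0.
rewrite /= apply_killed_out //; last exact: alive_in.
rewrite [leRHS]/alive xB; apply: le_trans (_ : _ <= Pf (fun=> 1) x) _.
  by apply: apply_P_le => // y; rewrite /alive lern1 leq_b1.
by rewrite apply_P_const.
Qed.

Lemma survival_le B s t x : (s <= t)%N -> survival B t x <= survival B s x.
Proof.
move/subnK <-; elim: (t - s)%N => //= n IH.
exact: le_trans (survivalS_le _ _ _) IH.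
Qed.

Lemma green_alive_sub B t x :
  green B (alive B) t x - Pf (green B (alive B) t) x <= 1.
Proof.
set g := green B (alive B) t.
have g0 y : 0 <= g y by apply: green_ge0 => z; exact: alive_ge0.
have [xB|xB] := boolP (x \in B).
  have : 0 <= Pf g x by apply: sumr_ge0 => y _; rewrite mulr_ge0.
  have -> : g x = 0 by apply: green_in => //; exact: alive_in.
  by move=> le; rewrite sub0r lerNl (le_trans _ le) // lerN10.
rewrite -(@apply_killed_out B) //; last first.
  by move=> y yB; apply: green_in => //; exact: alive_in.
(* Both sides are [green] at time [t.+1], split off at its last and at its first term. *)
have : g x + survival B t x = alive B x + Q B g x.
  by rewrite -greenS /green big_ord_recr.
have : alive B x <= 1 by rewrite /alive lern1 leq_b1.
have := survival_ge0 B t x; lra.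
Qed.

Variable gam : R.
Hypothesis gam_gt0 : 0 < gam.
Hypothesis gam_le1 : gam <= 1.
Hypothesis gap : forall mu, eigenvalue (PL adj) mu -> mu <> 1 -> mu <= 1 - gam.

(** Survival decreases in time, so [t] times its value at [t] is at most the truncated hitting time,
    whose mean is bounded. Hence survival decays like [1 / t]. *)
Lemma survival_mean B t :
  gam * (\sum_(x in B) w x) * (t%:R * \sum_x w x * survival B t x) <= vol ^+ 2.
Proof.
pose g := green B (alive B) t.
have g0 y : 0 <= g y by apply: green_ge0 => z; exact: alive_ge0.
have gB x : x \in B -> g x = 0 by move=> xB; apply: green_in => //; exact: alive_in.
have := subsolution_mean sym_adj connected_adj deg_gt0 gam_gt0 gam_le1 gap g0 gB
  (green_alive_sub B t).
apply: le_trans; apply: ler_wpM2l.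
  by rewrite mulr_ge0 ?sumr_ge0 // ltW.
rewrite mulr_sumr; apply: ler_sum => x _; rewrite mulrCA ler_wpM2l //.
rewrite /g /green mulr_natl -[X in _ *+ X](card_ord t) -sumr_const.
apply: ler_sum => j _; apply: survival_le; exact: ltnW.
Qed.

Local Notation hit := (hit_upto adj).

Lemma hit0 S x y : hit S x 0 y = ((y \in S) && (y == x))%:R.
Proof. by rewrite /=; case: ifP => //; case: ifP. Qed.

Lemma hitS_in S x t y : y \in S -> hit S x t y = (y == x)%:R.
Proof. by case: t => [|t] /= ->; case: ifP. Qed.

Lemma hitS_out S x t y : y \notin S -> hit S x t.+1 y = Pf (hit S x t) y.
Proof. by move=> /negbTE /= ->. Qed.

Lemma hit_ge0 S x t y : 0 <= hit S x t y.
Proof.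
elim: t y => [|t IH] y; first by rewrite hit0.
have [yS|yS] := boolP (y \in S); first by rewrite hitS_in.
by rewrite hitS_out //; apply: sumr_ge0 => z _; rewrite mulr_ge0.
Qed.

Lemma hit_le1 S x t y : hit S x t y <= 1.
Proof.
elim: t y => [|t IH] y; first by rewrite hit0 lern1 leq_b1.
have [yS|yS] := boolP (y \in S); first by rewrite hitS_in // lern1 leq_b1.
rewrite hitS_out //; apply: le_trans (_ : _ <= Pf (fun=> 1) y) _.
  exact: apply_P_le.
by rewrite apply_P_const.
Qed.

Lemma hitS_ge S x t y : hit S x t y <= hit S x t.+1 y.
Proof.
elim: t y => [|t IH] y; (have [yS|yS] := boolP (y \in S); first by rewrite !hitS_in).
  rewrite hit0 (negbTE yS) hitS_out //; apply: sumr_ge0 => z _.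
  by rewrite mulr_ge0 ?hit_ge0.
by rewrite !hitS_out //; apply: apply_P_le.
Qed.

Lemma sum_hit S t y : \sum_(x in S) hit S x t y = 1 - survival S t y.
Proof.
elim: t y => [|t IH] y; have [yS|yS] := boolP (y \in S).
- rewrite survival_in // subr0 (bigD1 y) // hit0 yS eqxx big1 /= ?addr0 // => x /andP[_].
  by rewrite yS eq_sym => /negbTE->.
- rewrite big1 => [|x _]; last by rewrite hit0 (negbTE yS).
  by rewrite /survival /= /alive yS subrr.
- rewrite survival_in // subr0 (bigD1 y) // hitS_in // eqxx big1 /= ?addr0 // => x /andP[_].
  by rewrite yS eq_sym => /negbTE->.
under eq_bigr do rewrite hitS_out //.
rewrite /apply exchange_big /=; under eq_bigr do rewrite -mulr_sumr IH mulrBr mulr1.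
rewrite sumrB sum_P //; congr (_ - _).
by rewrite [RHS]apply_killed_out // => z zS; rewrite survival_in.
Qed.

(** Decomposition by the last step: a walk from outside [B] that arrives at [x] has stayed outside
    [B] until it jumps to [x] with probability [P adj z x]. *)
Lemma hit_le_green (A : {set T}) x t y :
  let S := bdry adj A in let B := A :|: S in y \notin B ->
  hit S x t y <= green B (fun z => if z \in B then 0 else P adj z x) t y.
Proof.
move=> S B; elim: t y => [|t IH] y yB.
  have /negbTE yS : y \notin S by apply: contra yB; rewrite in_setU => ->; rewrite orbT.
  by rewrite hit0 yS /green big_ord0.
have yS : y \notin S by apply: contra yB; rewrite in_setU => ->; rewrite orbT.
have yA : y \notin A by apply: contra yB; rewrite in_setU => ->.
rewrite hitS_out // greenS (negbTE yB) /apply.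
have -> : P adj y x = \sum_z P adj y z * (z == x)%:R.
  rewrite (bigD1 x) //= eqxx mulr1 big1 ?addr0 // => z /negbTE->; exact: mulr0.
rewrite -big_split /=; apply: ler_sum => z _; rewrite /killed (negbTE yB) /=.
have [zB|zB] := boolP (z \in B); last first.
  by rewrite ler_wpDl ?mulr_ge0 // ler_wpM2l // IH.
rewrite mul0r addr0; have [zS|zS] := boolP (z \in S); first by rewrite hitS_in.
(* The walk cannot jump from [y] straight into [A]: then [y] would lie in the outer boundary [S]. *)
have zA : z \in A by move: zB; rewrite in_setU (negbTE zS) orbF.
rewrite {1 2}/P; case: ifP => [yz|_]; last by rewrite !mul0r.
case/negP: yS; rewrite inE yA; apply/existsP; exists z; by rewrite zA.
Qed.

End KilledWalk.

(** * Harmonic measure *)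

Section Limits.

Lemma Un_cv_limit u l : Un_cv u l -> limit u = l.
Proof.
move=> cvu; apply: UL_sequence (cvu).
by apply: (epsilon_spec (inhabits R0) (fun l => Un_cv u l)); exists l.
Qed.

Lemma Un_cv_eventually (u : nat -> R) c N :
  (forall t, (N <= t)%N -> u t = c) -> Un_cv u c.
Proof.
move=> uc eps eps0; exists N => t /ssrnat.leP/uc ->.
by rewrite RealsE subrr normr0; apply/RltP; move/RltP: eps0.
Qed.

Lemma Un_cv_sum (I : finType) (D : pred I) (u : I -> nat -> R) (l : I -> R) :
  (forall i, Un_cv (u i) (l i)) ->
  Un_cv (fun t => \sum_(i | D i) u i t) (\sum_(i | D i) l i).
Proof.
move=> cvu; elim: (index_enum I) => [|i r IH].
  by apply: (@Un_cv_eventually _ _ 0) => t _; rewrite !big_nil.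
rewrite big_cons; apply: (@Un_cv_ext (fun t =>
    (if D i then u i t + \sum_(i <- r | D i) u i t else \sum_(i <- r | D i) u i t))).
  by move=> t; rewrite big_cons.
by case: (D i) => //; apply: CV_plus.
Qed.

Lemma Un_cv_mulr_bounded (u : nat -> R) C :
  (forall t, 0 <= u t) -> (forall t, t%:R * u t <= C) -> Un_cv u 0.
Proof.
move=> u0 uC eps /RltP eps0; have [N] := INR_archimed eps C (elimT RltP eps0).
move=> /RltP; rewrite INRE RealsE => NC; exists N => t /ssrnat.leP Nt.
apply/RltP; rewrite RealsE subr0 ger0_norm // ltNge; apply/negP => le.
have := uC t; apply/negP; rewrite -ltNge; apply: (lt_le_trans NC).
by apply: ler_pM => //; [exact: ltW | rewrite ler_nat].
Qed.

Lemma Un_cv_le (u : nat -> R) l c : (forall t, u t <= c) -> Un_cv u l -> l <= c.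
Proof.
move=> uc cvu; apply/RleP; apply: (@Rle_cv_lim u (fun=> c)) cvu _.
  by move=> t; apply/RleP.
exact: (@Un_cv_eventually _ _ 0).
Qed.

Lemma Un_cv_ge (u : nat -> R) l c : (forall t, c <= u t) -> Un_cv u l -> c <= l.
Proof.
move=> uc cvu; apply/RleP; apply: (@Rle_cv_lim (fun=> c) u) _ cvu.
  by move=> t; apply/RleP.
exact: (@Un_cv_eventually _ _ 0).
Qed.

End Limits.

Section HarmonicMeasure.
Variables (T : finType) (adj : rel T).
Hypothesis sym_adj : symmetric adj.
Hypothesis connected_adj : forall x y, connect adj x y.
Hypothesis deg_gt0 : forall x, (0 < deg adj x)%N.
Implicit Types (f g : T -> R) (x y z : T) (B S : {set T}).

Local Notation w := (weight adj).
Local Notation vol := (vol adj).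
Local Notation hit := (hit_upto adj).

Let w_ge0 x : 0 <= w x := weight_ge0 deg_gt0 x.
Let w_gt0 x : 0 < w x := weight_gt0 deg_gt0 x.
Let Pge0 x y : 0 <= P adj x y := P_ge0 deg_gt0 x y.
Hint Resolve w_ge0 w_gt0 Pge0 : core.

(** The truncated probabilities increase in [t] and stay below 1, so the limit picked by choice is a
    true limit. *)
Lemma hitprob_cv S x y : Un_cv (fun t => hit S x t y) (hitprob adj S x y).
Proof.
have [l cvl] : {l | Un_cv (fun t => hit S x t y) l}.
  apply: growing_cv; first by move=> t; apply/RleP; exact: hitS_ge.
  by exists 1 => r [t ->]; apply/RleP; exact: hit_le1.
by rewrite /hitprob (Un_cv_limit cvl).
Qed.

Lemma harm_cv S x :
  Un_cv (fun t => (\sum_y w y * hit S x t y) / vol) (harm adj S x).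
Proof.
apply: (@Un_cv_ext (fun t => \sum_y pi adj y * hit S x t y)).
  by move=> t; rewrite mulr_suml; apply: eq_bigr => y _; rewrite pi_weight mulrAC.
apply: Un_cv_sum => y; apply: CV_mult; last exact: hitprob_cv.
exact: (@Un_cv_eventually _ _ 0).
Qed.

Lemma harm_ge0 S x : 0 <= harm adj S x.
Proof.
apply: Un_cv_ge (harm_cv S x) => t.
rewrite divr_ge0 ?sumr_ge0 // => y _; exact: mulr_ge0 (hit_ge0 deg_gt0 _ _ _ _).
Qed.

Variable gam : R.
Hypothesis gam_gt0 : 0 < gam.
Hypothesis gam_le1 : gam <= 1.
Hypothesis gap : forall mu, eigenvalue (PL adj) mu -> mu <> 1 -> mu <= 1 - gam.

(** The mass absorbed by time [t] is 1 minus the mean survival, which tends to 0 by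
    [survival_mean]. *)
Lemma sum_harm S : S != set0 -> \sum_(x in S) harm adj S x = 1.
Proof.
case/set0Pn => x0 x0S; have V := vol_gt0 deg_gt0 x0.
have cv1 := Un_cv_sum (mem S) (harm_cv S).
pose e t := (\sum_y w y * survival adj S t y) / vol.
have E t : \sum_(x in S) ((\sum_y w y * hit S x t y) / vol) = 1 - e t.
  rewrite -mulr_suml exchange_big /=.
  under eq_bigr do rewrite -mulr_sumr sum_hit // mulrBr mulr1.
  by rewrite sumrB mulrBl divff ?gt_eqF.
have wS : 0 < \sum_(x in S) w x.
  by rewrite (bigD1 x0) //= ltr_pwDl // sumr_ge0.
have cv0 : Un_cv e 0.
  apply: (@Un_cv_mulr_bounded _ (vol / (gam * \sum_(x in S) w x))) => t.
    rewrite divr_ge0 ?(ltW V) ?sumr_ge0 // => y _.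
    by rewrite mulr_ge0 // survival_ge0.
  have := survival_mean sym_adj connected_adj deg_gt0 gam_gt0 gam_le1 gap S t.
  move=> le_vol; rewrite /e ler_pdivlMr ?mulr_gt0 // -(ler_pM2r V) -expr2.
  apply: le_trans le_vol; rewrite le_eqVlt; apply/orP; left; apply/eqP.
  by field; rewrite gt_eqF.
have cv2 : Un_cv (fun t => 1 - e t) 1.
  have cvc : Un_cv (fun=> 1) 1 by exact: (@Un_cv_eventually _ _ 0).
  by have := CV_minus _ _ _ _ cvc cv0; rewrite RealsE subr0.
apply: UL_sequence cv1 _.
by apply: Un_cv_ext cv2 => t; rewrite E.
Qed.

Lemma harm_le (d L : nat) (A : {set T}) x :
  (forall y, (deg adj y <= d)%N) -> 1 <= L%:R * gam ->
  (0 < #|A|)%N -> (#|A| ^ 2 <= #|T|)%N ->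
  harm adj (bdry adj A) x <= d%:R * (2 + L%:R + 2 / gam) / #|A|%:R.
Proof.
move=> degd L1 A0 A2; have V := vol_gt0 deg_gt0 x.
set S := bdry adj A; set B := A :|: S; set a := #|A|.
have a0 : 0 < a%:R :> R by rewrite ltr0n.
have wd y : w y <= d%:R by rewrite /weight ler_nat.
have a2 : a%:R * a%:R <= vol.
  apply: le_trans (card_le_vol deg_gt0); by rewrite -natrM mulnn ler_nat.
have a1 : 1 <= a%:R :> R by rewrite ler1n.
pose M : R := (L * a)%:R + 2 * vol / (gam * a%:R).
pose p z := if z \in B then 0 else P adj z x.
have p0 z : 0 <= p z by rewrite /p; case: ifP.
apply: Un_cv_le (harm_cv S x) => t; rewrite ler_pdivrMr //.
pose g := green adj B (alive B) t.
have g0 y : 0 <= g y by apply: green_ge0 => // z; exact: alive_ge0.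
have gM z : g z <= M.
  apply: (subsolution_le sym_adj connected_adj deg_gt0 gam_gt0 gam_le1 gap (B := B) g0
    _ (green_alive_sub deg_gt0 B t)) => //.
    by move=> y yB; apply: green_in (yB) => u; exact: alive_in.
  by rewrite subset_leq_card // subsetUl.
(* Three kinds of starting points: in [A], where the trivial bound 1 is used; at [x] itself; and
   outside [B], where [hit_le_green] applies. *)
have hle y : w y * hit S x t y <=
    (if y \in A then d%:R else 0) + w y * (y == x)%:R + w y * alive B y * green adj B p t y.
  have [yB|yB] := boolP (y \in B); last first.
    have /negbTE-> : y \notin A by apply: contra yB; rewrite in_setU => ->.
    rewrite add0r ler_wpDl ?mulr_ge0 // /alive yB mulr1 ler_wpM2l //.
    exact: hit_le_green.
  rewrite (alive_in yB) mulr0 mul0r addr0.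
  have [yA|yA] := boolP (y \in A).
    rewrite ler_wpDr ?mulr_ge0 //; apply: le_trans (wd y).
    by rewrite ler_piMr // hit_le1.
  have yS : y \in S by move: yB; rewrite in_setU (negbTE yA).
  by rewrite add0r hitS_in.
apply: le_trans (ler_sum _ (fun y _ => hle y)) _.
rewrite !big_split /= -big_mkcond sumr_const -/a.
rewrite [X in _ + X + _](bigD1 x) //= eqxx mulr1 big1 ?addr0; last first.
  by move=> y /negbTE->; rewrite mulr0.
(* After the exchange, [g] is the capped expected hitting time of [B], weighted by the edges from
   [x]. *)
have -> : \sum_y w y * alive B y * green adj B p t y = \sum_y w y * p y * g y.
  exact: greenC.
have dM : \sum_y w y * p y * g y <= d%:R * M.
  apply: (@le_trans _ _ (\sum_y (adj x y)%:R * M)).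
    apply: ler_sum => y _; rewrite /p; case: ifP => _.
      by rewrite mulr0 mul0r mulr_ge0 // (le_trans (g0 x)).
    by rewrite weight_P // sym_adj ler_wpM2l.
  by rewrite -mulr_suml sum_adj ler_wpM2r ?wd // (le_trans (g0 x)).
have d0 : 0 <= d%:R :> R by [].
(* The hypothesis [#|A| ^ 2 <= #|T|] makes [a <= X], so the terms [a], [1] and [L * a] are all
   absorbed into multiples of [X]. *)
set X := vol / a%:R.
have aX : a%:R <= X by rewrite /X ler_pdivlMr.
have -> : d%:R * (2 + L%:R + 2 / gam) / a%:R * vol =
    d%:R * (2 * X + L%:R * X + 2 * vol / (gam * a%:R)).
  by rewrite /X; field; rewrite !gt_eqF.
rewrite -[d%:R *+ a]mulr_natl.
apply: (@le_trans _ _ (d%:R * (a%:R + 1 + M))).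
  by rewrite mulrDr lerD // mulrDr mulr1 (mulrC d%:R a%:R) lerD2l.
rewrite ler_wpM2l // /M addrA lerD2r natrM.
have : L%:R * a%:R <= L%:R * X by rewrite ler_wpM2l.
lra.
Qed.

End HarmonicMeasure.

(** * Growth of the aggregate *)

Section Distance.
Variables (T : finType) (adj : rel T).
Implicit Types x y z : T.

Definition walk x y (k : nat) :=
  [exists p : k.-tuple T, path adj x p && (last x p == y)].

Lemma walkP x y k :
  reflect (exists p, [/\ size p = k, path adj x p & last x p = y]) (walk x y k).
Proof.
apply: (iffP existsP) => [[p /andP[pth /eqP lst]]|[p [/eqP sz pth lst]]].
  by exists p; rewrite size_tuple.
by exists (Tuple sz); rewrite /= pth lst eqxx.
Qed.

Lemma gdist_le x y k : walk x y k -> (gdist adj x y <= k)%N.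
Proof.
move=> wk; rewrite leqNgt; apply/negP => lt.
have := before_find 0%N lt; rewrite nth_iota ?add0n => [|].
  by rewrite -/(walk x y k) wk.
by apply: leq_trans lt _; rewrite -[leqRHS](size_iota 0) find_size.
Qed.

(** [gdist] is a [find] over [iota 0 #|T|], whose value [#|T|] means that no walk was found; hence
    the strict bound. *)
Lemma walk_gdist x y : (gdist adj x y < #|T|)%N -> walk x y (gdist adj x y).
Proof.
move=> lt; have hs : has (walk x y) (iota 0 #|T|) by rewrite has_find size_iota.
by have := nth_find 0%N hs; rewrite nth_iota // add0n.
Qed.

Lemma gdistxx x : gdist adj x x = 0%N.
Proof. by apply/eqP; rewrite -leqn0; apply: gdist_le; apply/walkP; exists [::]. Qed.

Lemma gdist_adj x y z : adj y z -> (gdist adj x z <= (gdist adj x y).+1)%N.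
Proof.
move=> yz; have [lt|ge] := ltnP (gdist adj x y) #|T|; last first.
  apply: leq_trans (leqW ge).
  by rewrite -[leqRHS](size_iota 0) find_size.
have /walkP[p [sz pth lst]] := walk_gdist lt.
apply: gdist_le; apply/walkP; exists (rcons p z).
by rewrite size_rcons sz rcons_path pth lst yz last_rcons.
Qed.

Fixpoint ball (k : nat) x : {set T} :=
  if k is k'.+1 then x |: \bigcup_(z in [set z | adj x z]) ball k' z else [set x].

Lemma walk_ball k p x : path adj x p -> (size p <= k)%N -> last x p \in ball k x.
Proof.
elim: k p x => [|k IH] [|z p] x //=; rewrite ?inE ?eqxx //.
case/andP=> xz pth sz; apply/orP; right.
by apply/bigcupP; exists z; [rewrite inE | exact: IH].
Qed.

Lemma card_bigcup_le (I : finType) (D : {set I}) (F : I -> {set T}) m :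
  (forall i, (#|F i| <= m)%N) -> (#|\bigcup_(i in D) F i| <= #|D| * m)%N.
Proof.
move=> Fm; rewrite -sum_nat_const.
elim/big_ind2: _ => [|A a B b Aa Bb|i _]; rewrite ?cards0 //.
by apply: leq_trans (leq_add Aa Bb); rewrite cardsU leq_subr.
Qed.

Lemma card_ball d k x : (forall y, (deg adj y <= d)%N) -> (#|ball k x| <= d.+1 ^ k)%N.
Proof.
move=> degd; elim: k x => [|k IH] x /=; first by rewrite cards1.
rewrite expnS mulSn; apply: leq_trans (_ : _ <= 1 + d * d.+1 ^ k)%N _.
  rewrite cardsU cards1 (leq_trans (leq_subr _ _)) // leq_add2l.
  apply: leq_trans (card_bigcup_le _ IH) _; rewrite leq_mul2r; apply/orP; right; exact: degd.
by rewrite leq_add2r expn_gt0.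
Qed.

Lemma card_le_expn_gdiam d : (1 <= d)%N -> (forall y, (deg adj y <= d)%N) ->
  (#|T| <= d.+1 ^ gdiam adj)%N.
Proof.
(* If the diameter reaches the default value [#|T|], then [n < d.+1 ^ n] suffices; otherwise every
   pair is joined by a walk of length at most the diameter, and a ball covers the graph. *)
move=> d1 degd; have [ge|lt] := leqP #|T| (gdiam adj).
  apply: leq_trans ge _; apply: ltnW; exact: ltn_expl.
case: (pickP T) => [x _|T0]; last by rewrite eq_card0 // => x; move: (T0 x).
apply: leq_trans (card_ball (gdiam adj) x degd); rewrite -cardsT subset_leq_card //.
apply/subsetP => y _.
have le : (gdist adj x y <= gdiam adj)%N.
  apply: leq_trans (leq_bigmax x); exact: (leq_bigmax (F := gdist adj x) y).
have /walkP[p [sz pth <-]] := walk_gdist (leq_ltn_trans le lt).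
by apply: walk_ball => //; rewrite sz.
Qed.

End Distance.

(** Bernoulli's inequality [1 + K / a <= (1 + 1 / a) ^ K], cleared of denominators. *)
Lemma bernoulli_mul (a : R) (K : nat) : 0 <= a ->
  (a + K%:R) * a ^+ K <= a * (a + 1) ^+ K.
Proof.
move=> a0; elim: K => [|K IH]; first by rewrite addr0.
have le : a ^+ K <= (a + 1) ^+ K by rewrite lerXn2r ?nnegrE ?addr_ge0 ?lerDl.
have : a * ((a + K%:R) * a ^+ K + a ^+ K) <= a * (a * (a + 1) ^+ K + (a + 1) ^+ K).
  by rewrite ler_wpM2l // lerD.
rewrite !exprS -natr1; set u := a ^+ K; set v := (a + 1) ^+ K => {}le.
have -> : (a + (K%:R + 1)) * (a * u) = a * ((a + K%:R) * u + u) by ring.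
have -> : a * ((a + 1) * v) = a * (a * v + v) by ring.
exact: le.
Qed.

(** * The law of the aggregate and the supermartingale *)

Section Aggregation.
Variables (T : finType) (adj : rel T) (s e : T).
Hypothesis sym_adj : symmetric adj.
Hypothesis connected_adj : forall x y, connect adj x y.
Implicit Types A B : {set T}.

Local Notation law := (dla_law adj s e).
Local Notation h A := (harm adj (bdry adj A)).

Hypothesis h_ge0 : forall A x, 0 <= h A x.
Hypothesis sum_h : forall A, bdry adj A != set0 -> \sum_(x in bdry adj A) h A x = 1.

Definition dla_step A B : R :=
  if e \in A then (B == A)%:R
  else \sum_(a in bdry adj A) (B == a |: A)%:R * h A a.

Lemma dla_lawS t B : law t.+1 B = \sum_A law t A * dla_step A B.
Proof.
apply: eq_bigr => A _; congr (_ * _); rewrite /dla_step.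
case: ifP => _; first by case: eqP.
rewrite rsumE [RHS]big_mkcond; apply: eq_bigr => a _.
by case: (a \in _); case: eqP; rewrite ?mul0r ?mul1r.
Qed.

Lemma dla_law_ge0 t A : 0 <= law t A.
Proof.
elim: t A => [|t IH] A; first by rewrite /=; case: ifP.
rewrite dla_lawS sumr_ge0 // => B _; rewrite mulr_ge0 // /dla_step.
by case: ifP => // _; apply: sumr_ge0 => a _; rewrite mulr_ge0.
Qed.

(** Before [e] is reached each step adds exactly one new vertex to the initial one, so the size at
    time [t] is [t.+1]. *)
Lemma dla_law_supp t B :
  ~~ [&& s \in B & (e \in B) || (#|B| == t.+1)] -> law t B = 0.
Proof.
elim: t B => [|t IH] B.
  by rewrite /=; have [->|//] := eqVneq B [set s]; rewrite set11 cards1 orbT.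
move=> nB; rewrite dla_lawS big1 // => A _.
have [/andP[sA eA]|/IH->] := boolP [&& s \in A & (e \in A) || (#|A| == t.+1)];
  last by rewrite mul0r.
rewrite /dla_step; case: ifP => [eA1|eA1].
  have [BA|_] := eqVneq B A; last by rewrite mulr0.
  by move: nB; rewrite BA sA eA1.
rewrite big1 ?mulr0 // => a aA; have [BA|_] := eqVneq B (a |: A); last by rewrite mul0r.
have aNA : a \notin A by move: aA; rewrite inE => /andP[].
move: nB; rewrite BA.
by rewrite in_setU sA orbT cardsU1 aNA; move: eA; rewrite eA1 /= => /eqP->; rewrite eqxx orbT.
Qed.

Lemma dla_expect t (phi : {set T} -> R) :
  \sum_B law t.+1 B * phi B = \sum_A law t A *
    (if e \in A then phi A else \sum_(a in bdry adj A) h A a * phi (a |: A)).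
Proof.
under eq_bigr do rewrite dla_lawS mulr_suml.
rewrite exchange_big; apply: eq_bigr => A _ /=.
under eq_bigr do rewrite -mulrA.
rewrite -mulr_sumr; congr (_ * _); rewrite /dla_step; case: ifP => _.
  rewrite (bigD1 A) //= eqxx mul1r big1 ?addr0 // => B /negbTE->; exact: mul0r.
under [LHS]eq_bigr do rewrite mulr_suml.
rewrite exchange_big; apply: eq_bigr => a _ /=.
rewrite (bigD1 (a |: A)) //= eqxx mul1r big1 ?addr0 // => B /negbTE->.
by rewrite !mul0r.
Qed.

Lemma bdry_neq0 A : s \in A -> e \notin A -> bdry adj A != set0.
Proof.
move=> sA; apply: contraNneq => bA; have [p pth ->] := connectP (connected_adj s e).
elim: p s sA pth => //= z p IH x xA /andP[xz pth]; apply: IH pth.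
apply: contraT => zA; have : z \in bdry adj A; last by rewrite bA inE.
by rewrite inE zA; apply/existsP; exists x; rewrite xA sym_adj.
Qed.

Lemma sum_dla_law t : \sum_A law t A = 1.
Proof.
elim: t => [|t IH].
  rewrite (bigD1 [set s]) //= eqxx big1 ?addr0 // => A /negbTE->; by [].
have := dla_expect t (fun=> 1); under eq_bigr do rewrite mulr1.
move=> ->; rewrite -[RHS]IH; apply: eq_bigr => A _.
case: ifPn => [_|eA]; first by rewrite mulr1.
have [sA|sA] := boolP (s \in A); last by rewrite dla_law_supp ?mul0r // (negbTE sA).
under eq_bigr do rewrite mulr1.
by rewrite sum_h ?mulr1 // bdry_neq0.
Qed.

Lemma dla_law_out t A : (#|T| <= t)%N -> e \notin A -> law t A = 0.
Proof.
move=> Tt /negbTE eA; apply: dla_law_supp; rewrite eA /= negb_and.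
by rewrite neq_ltn ltnS (leq_trans (max_card _) Tt) orbT.
Qed.

(** An aggregate without [e] would have more than [#|T|] vertices by then. The law is thus
    eventually constant, and the limit defining [dla_prob_final_ge] is attained. *)
Lemma dla_law_stop t A : (#|T| <= t)%N -> law t A = law #|T| A.
Proof.
move/subnK <-; elim: (t - _)%N => [//|n IH]; rewrite -[RHS]IH addSn dla_lawS.
rewrite (bigD1 A) //= big1 ?addr0 => [|B BA].
  rewrite /dla_step eqxx; case: ifPn => eA; first by rewrite mulr1.
  by rewrite dla_law_out ?leq_addl // mul0r.
rewrite /dla_step; case: ifPn => eB; first by rewrite eq_sym (negbTE BA) mulr0.
by rewrite dla_law_out ?leq_addl // mul0r.
Qed.

Lemma dla_prob_final_geE x :
  dla_prob_final_ge adj s e x =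
  1 - \sum_(A : {set T} | (e \in A) && (#|A|%:R < x)) law #|T| A.
Proof.
apply: Un_cv_limit; apply: (@Un_cv_eventually _ _ #|T|) => t Tt.
apply/eqP; rewrite eq_sym subr_eq -[eqbLHS](sum_dla_law #|T|) eq_sym; apply/eqP.
rewrite [X in _ + X]big_mkcond -big_split /=; apply: eq_bigr => A _.
rewrite dla_law_stop //; have [eA|eA] := boolP (e \in A); last first.
  by rewrite /= dla_law_out // addr0.
have -> : (if Rle_dec x (INR #|A|) then true else false) = (x <= #|A|%:R).
  rewrite -INRE; case: Rle_dec => le; apply/esym; first exact/RleP.
  by apply/negbTE/negP => /RleP.
by rewrite ltNge; case: (x <= _); rewrite /= ?addr0 ?add0r.
Qed.

Variables (d K : nat) (C x : R).
Hypothesis d1 : (1 <= d)%N.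
Hypothesis degd : forall y, (deg adj y <= d)%N.
Hypothesis h_le : forall A y, (0 < #|A|)%N -> (#|A| ^ 2 <= #|T|)%N ->
  h A y <= C / #|A|%:R.
Hypothesis C0 : 0 <= C.
Hypothesis CK : C * (d * d.+1)%:R <= K%:R.
Hypothesis x_gt1 : 1 < x.
Hypothesis x_sqr : x ^+ 2 <= #|T|%:R.
Hypothesis dist_se : gdist adj s e = gdiam adj.

Definition potential A : R := \sum_(v in A) (d.+1 ^ gdist adj s v)%:R.

Lemma potential_ge0 A : 0 <= potential A.
Proof. exact: sumr_ge0. Qed.

(** A boundary vertex has a neighbour in [A], from which its distance to [s] exceeds by at most 1;
    each vertex of [A] is charged at most [d] times. *)
Lemma potential_bdry A : potential (bdry adj A) <= (d * d.+1)%:R * potential A.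
Proof.
pose q y : R := (d.+1 ^ (gdist adj s y).+1)%:R.
have le v : v \in bdry adj A ->
    (d.+1 ^ gdist adj s v)%:R <= \sum_(y in A) (adj v y)%:R * q y.
  rewrite inE => /andP[_ /existsP[y /andP[yA vy]]].
  rewrite (bigD1 y) //= vy mul1r ler_wpDr ?sumr_ge0 // => [z _|].
    by rewrite mulr_ge0.
  by rewrite ler_nat leq_pexp2l // gdist_adj // sym_adj.
apply: le_trans (ler_sum _ le) _; rewrite exchange_big /= mulr_sumr.
apply: ler_sum => y _; rewrite -mulr_suml.
have -> : (d * d.+1)%:R * (d.+1 ^ gdist adj s y)%:R = d%:R * q y.
  by rewrite /q expnS -!natrM mulnA.
apply: ler_wpM2r => //; rewrite -natr_sum ler_nat; apply: leq_trans (degd y).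
rewrite /deg -sum1_card [leqRHS]big_mkcond /= [leqLHS]big_mkcond leq_sum // => v _.
by rewrite inE sym_adj; case: ifP => //; case: adj.
Qed.

(** Cut to 0 once the aggregate reaches size [x], beyond which the bound on harmonic measure is no
    longer at hand. *)
Definition lyapunov A : R :=
  if #|A|%:R < x then potential A / #|A|%:R ^+ K else 0.

Lemma lyapunov_ge0 A : 0 <= lyapunov A.
Proof.
rewrite /lyapunov; case: ifP => // _.
by rewrite divr_ge0 ?potential_ge0 // exprn_ge0.
Qed.

Lemma lyapunov_step A : s \in A -> e \notin A ->
  \sum_(a in bdry adj A) h A a * lyapunov (a |: A) <= lyapunov A.
Proof.
move=> sA eA; set n : R := #|A|%:R.
have cardA a : a \in bdry adj A -> #|a |: A|%:R = n + 1.
  by rewrite inE => /andP[aA _]; rewrite cardsU1 aA natrD addrC.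
have n0 : 0 < n by rewrite ltr0n; apply/card_gt0P; exists s.
rewrite {2}/lyapunov; case: ifPn => [lt|]; last first.
  rewrite -leNgt => ge; rewrite big1 // => a aA.
  rewrite /lyapunov cardA // ifN ?mulr0 // -leNgt; apply: (le_trans ge).
  by rewrite lerDl.
have A2 : (#|A| ^ 2 <= #|T|)%N.
  rewrite -(ler_nat R) natrX; apply: le_trans x_sqr.
  by rewrite lerXn2r ?nnegrE ?ltW // (lt_trans ltr01).
have A0 : (0 < #|A|)%N by rewrite -(ltr0n R).
set F := potential A.
have F0 : 0 <= F := potential_ge0 A.
(* The old potential keeps the exact [h A a], which sums to 1; the increment gets the pointwise
   bound [C / n]. *)
apply: (@le_trans _ _ (\sum_(a in bdry adj A)
    (h A a * F + C / n * (d.+1 ^ gdist adj s a)%:R) / (n + 1) ^+ K)).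
  apply: ler_sum => a aA; apply: (@le_trans _ _ (h A a * ((F + (d.+1 ^ gdist adj s a)%:R) / (n + 1) ^+ K))).
    apply: ler_wpM2l => //; rewrite /lyapunov cardA //.
    have aNA : a \notin A by move: aA; rewrite inE => /andP[].
    rewrite /potential big_setU1 //= addrC; case: ifP => // _.
    by rewrite divr_ge0 ?exprn_ge0 ?addr_ge0 // ltW.
  rewrite mulrA ler_wpM2r ?invr_ge0 ?exprn_ge0 ?addr_ge0 ?(ltW n0) //.
  by rewrite mulrDr lerD2l ler_wpM2r // h_le.
rewrite -mulr_suml big_split /= -mulr_suml sum_h ?bdry_neq0 // mul1r -mulr_sumr.
have n1 : 0 < n + 1 by rewrite addr_gt0.
rewrite ler_pdivrMr ?exprn_gt0 // [leRHS]mulrAC ler_pdivlMr ?exprn_gt0 //.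
(* The expected potential grows by at most the factor [1 + K / n], which the change of denominator
   from [n ^+ K] to [(n + 1) ^+ K] compensates. *)
apply: (@le_trans _ _ (F * ((n + K%:R) / n) * n ^+ K)).
  rewrite ler_wpM2r ?exprn_ge0 ?(ltW n0) //.
  rewrite mulrDl divff ?gt_eqF // mulrDr mulr1 lerD2l.
  rewrite -mulrA mulrCA [_ / n]mulrC [leRHS]mulrCA ler_wpM2l ?invr_ge0 ?(ltW n0) //.
  apply: (@le_trans _ _ (C * ((d * d.+1)%:R * F))).
    by rewrite ler_wpM2l // potential_bdry.
  by rewrite mulrA mulrC ler_wpM2l.
rewrite -mulrA ler_wpM2l // mulrAC ler_pdivrMr // [leRHS]mulrC.
exact/bernoulli_mul/ltW.
Qed.

Lemma lyapunov_expect t : \sum_A law t A * lyapunov A <= 1.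
Proof.
elim: t => [|t IH].
  rewrite (bigD1 [set s]) //= eqxx mul1r big1 ?addr0 => [|A /negbTE->]; last exact: mul0r.
  rewrite /lyapunov cards1 x_gt1 expr1n divr1 /potential big_set1 gdistxx.
  by [].
rewrite dla_expect; apply: le_trans IH; apply: ler_sum => A _.
case: ifPn => // eA; have [sA|sA] := boolP (s \in A).
  by rewrite ler_wpM2l ?dla_law_ge0 // lyapunov_step.
by rewrite dla_law_supp ?mul0r // (negbTE sA).
Qed.

(** Markov's inequality: on this event [lyapunov] is at least [#|T| / x ^+ K], while its expectation
    is at most 1. *)
Lemma dla_small_prob t :
  \sum_(A : {set T} | (e \in A) && (#|A|%:R < x)) law t A <= x ^+ K / #|T|%:R.
Proof.
have T0 : 0 < #|T|%:R :> R by rewrite ltr0n; apply/card_gt0P; exists s.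
have x0 : 0 < x := lt_trans ltr01 x_gt1.
have xK : 0 < x ^+ K by rewrite exprn_gt0.
rewrite ler_pdivlMr // -[leRHS]mulr1.
apply: le_trans (_ : _ <= x ^+ K * \sum_A law t A * lyapunov A) _; last first.
  by rewrite ler_wpM2l ?(ltW xK) ?lyapunov_expect.
rewrite mulr_suml mulr_sumr big_mkcond; apply: ler_sum => A _.
case: ifP => [/andP[eA lt]|_]; last first.
  by rewrite !mulr_ge0 ?(ltW xK) ?dla_law_ge0 ?lyapunov_ge0.
rewrite [leRHS]mulrCA ler_wpM2l ?dla_law_ge0 // /lyapunov lt.
have A0 : 0 < #|A|%:R :> R by rewrite ltr0n; apply/card_gt0P; exists e.
apply: (@le_trans _ _ (potential A)).
  rewrite /potential (bigD1 e) //= dist_se ler_wpDr ?sumr_ge0 //.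
  by rewrite ler_nat card_le_expn_gdiam.
rewrite mulrCA ler_peMr ?potential_ge0 // ler_pdivlMr ?exprn_gt0 // mul1r.
by rewrite lerXn2r ?nnegrE ?ltW.
Qed.

End Aggregation.

(** * Assembling the estimates and choosing the exponent *)

Lemma connected_deg_gt0 (T : finType) (adj : rel T) :
  (forall x y, connect adj x y) -> (1 < #|T|)%N -> forall x, (0 < deg adj x)%N.
Proof.
move=> conn T1 x; have : (0 < #|predC1 x|)%N by rewrite -(ltn_add2l 1) (cardC1 x) addn0 add1n prednK // ltnW.
case/card_gt0P => y; rewrite inE => yx.
have [[|z p] /= pth yE] := connectP (conn x y); first by rewrite yE eqxx in yx.
by case/andP: pth => xz _; apply/card_gt0P; exists z; rewrite inE.
Qed.

Lemma archimedean_mul (u v : R) : 0 < u -> exists n : nat, v <= n%:R * u.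
Proof.
move=> u0; have [n] := INR_archimed u v (elimT RltP u0).
by move=> /RltP; rewrite INRE RealsE => /ltW le; exists n.
Qed.

Lemma dla_final_ge (T : finType) (adj : rel T) (s e : T) (d L K : nat) (gam x : R) :
  (1 <= d)%N -> symmetric adj -> (forall u v, connect adj u v) ->
  (1 < #|T|)%N -> (forall u, (deg adj u <= d)%N) ->
  0 < gam -> gam <= 1 ->
  (forall mu, eigenvalue (PL adj) mu -> mu <> 1 -> mu <= 1 - gam) ->
  gdist adj s e = gdiam adj ->
  1 <= L%:R * gam ->
  d%:R * (2 + L%:R + 2 / gam) * (d * d.+1)%:R <= K%:R ->
  1 < x -> x ^+ 2 <= #|T|%:R ->
  1 - x ^+ K / #|T|%:R <= dla_prob_final_ge adj s e x.
Proof.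
move=> d1 symA conn T1 degd g0 g1 gap dist L1 CK x1 x2.
have dg := connected_deg_gt0 conn T1.
have sumh A := @sum_harm _ _ symA conn dg _ g0 g1 gap (bdry adj A).
have hge0 A := harm_ge0 dg (bdry adj A).
rewrite (dla_prob_final_geE s e symA conn sumh) lerD2l lerN2.
apply: (dla_small_prob symA conn hge0 sumh d1 degd _ _ CK) => //.
  by move=> A y A0 A2; apply: harm_le A0 A2.
by rewrite mulr_ge0 // !addr_ge0 // divr_ge0 // ltW.
Qed.

Theorem mainTheorem9 (d : nat) (V : nat -> finType) (adj : forall n, rel (V n))
  (s e : forall n, V n) :
  (1 <= d)%N ->
  (forall n, symmetric (adj n)) ->
  (forall n, irreflexive (adj n)) ->
  (forall n (x y : V n), connect (adj n) x y) ->
  (forall M : nat, exists N : nat, forall n, (N <= n)%N -> (M <= #|V n|)%N) ->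
  (forall n (x : V n), (deg (adj n) x <= d)%N) ->
  (exists gam : R, Rlt 0 gam /\
     forall n (mu : R), eigenvalue (PL (adj n)) mu -> mu <> R1 -> Rle mu (Rminus R1 gam)) ->
  (forall n, gdist (adj n) (s n) (e n) = gdiam (adj n)) ->
  exists c : R, Rlt 0 c /\
    forall eps : R, Rlt 0 eps -> exists N : nat, forall n, (N <= n)%N ->
      Rle (Rminus R1 eps) (dla_prob_final_ge (adj n) (s n) (e n) (Rpower (INR #|V n|) c)).
Proof.
move=> d1 symA _ conn large degd [gam0 [/RltP gam0_gt0 gap0]] dist.
(* The cap at 1 keeps the contraction factor [1 - gam] nonnegative. *)
pose gam := Num.min gam0 1.
have gam_gt0 : 0 < gam by rewrite lt_min gam0_gt0 ltr01.
have gam_le1 : gam <= 1 by rewrite ge_min lexx orbT.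
have gap n mu : eigenvalue (PL (adj n)) mu -> mu <> 1 -> mu <= 1 - gam.
  move=> eig mu1; have /RleP le := gap0 _ _ eig mu1; apply: (le_trans le).
  by rewrite RealsE lerD2l lerN2 ge_min lexx.
have [L L1] := archimedean_mul 1 gam_gt0.
(* The successor taken below makes [K] positive, as needed for [c] and for
   [x ^+ 2 <= x ^+ (2 * K)]. *)
have [K'] := archimedean_mul (d%:R * (2 + L%:R + 2 / gam) * (d * d.+1)%:R) ltr01.
rewrite mulr1 => CK'; pose K := K'.+1.
have CK : d%:R * (2 + L%:R + 2 / gam) * (d * d.+1)%:R <= K%:R.
  by apply: le_trans CK' _; rewrite ler_nat.
(* With this exponent [x ^+ K] is the square root of [#|V n|], so the failure probability is at most
   [#|V n|] to the power -1/2. *)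
pose c := (2 * K)%:R^-1 : R.
have c0 : 0 < c by rewrite invr_gt0 ltr0n.
exists c; split=> [|eps /RltP eps0]; first exact/RltP.
(* From [m * eps ^+ 2 >= 1] and [#|V n| >= m] the failure probability is at most [eps]; at least 2
   vertices ensure [x > 1]. *)
have [m meps] := archimedean_mul 1 (exprn_gt0 2 eps0).
have [N Nlarge] := large (maxn 2 m); exists N => n /Nlarge.
rewrite geq_max => /andP[V2 Vm]; set x := Rpower _ _.
have V0 : 0 < #|V n|%:R :> R by rewrite ltr0n ltnW.
have V1 : 1 < #|V n|%:R :> R by rewrite ltr1n.
have x1 : 1 < x.
  have -> : 1 = Rpower (INR #|V n|) 0 by rewrite Rpower_O // INRE; apply/RltP.
  by apply/RltP; apply: Rpower_lt; [rewrite INRE|]; apply/RltP.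
have x0 : 0 < x by apply: lt_trans x1.
have xpow : x ^+ (2 * K) = #|V n|%:R.
  rewrite -RpowE -Rpower_pow; last exact/RltP.
  rewrite /x Rpower_mult [INR (2 * K)]INRE RmultE /c mulVf ?pnatr_eq0 //.
  by rewrite Rpower_1 INRE //; apply/RltP.
have x2 : x ^+ 2 <= #|V n|%:R.
  by rewrite -xpow ler_weXn2l ?(ltW x1) // leq_pmulr.
apply/RleP; apply: le_trans (dla_final_ge d1 (symA n) (@conn n) V2 (@degd n)
  gam_gt0 gam_le1 (gap n) (dist n) L1 CK x1 x2).
rewrite RealsE lerD2l lerN2 ler_pdivrMr //.
set y := x ^+ K; have y0 : 0 < y by rewrite exprn_gt0.
have Vy : #|V n|%:R = y ^+ 2 by rewrite -xpow mulnC exprM.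
rewrite Vy expr2 mulrA ler_peMl ?(ltW y0) //.
rewrite -(@ler_pXn2r _ 2) ?nnegrE ?ler01 ?mulr_ge0 ?(ltW eps0) ?(ltW y0) //.
rewrite expr1n exprMn -Vy mulrC; apply: (le_trans meps).
by rewrite ler_wpM2r ?sqr_ge0 // ler_nat.
Qed.
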